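(* Let $\widehat R$ be the matrix of right eigenvectors of the Powell-augmented ideal MHD flux Jacobian given in the context, and let $$T=\mathrm{diag}\left(\frac{1}{\sqrt{2\rho\gamma}},\ \sqrt{\frac{p}{2\rho^3}},\ \frac{1}{\sqrt{2\rho\gamma}},\ \sqrt{\frac{\rho(\gamma-1)}{\gamma}},\ \sqrt{\frac{p}{\rho}},\ \frac{1}{\sqrt{2\rho\gamma}},\ \sqrt{\frac{p}{2\rho^3}},\ \frac{1}{\sqrt{2\rho\gamma}}\right),\qquad Z=T^2 .$$ Then the entropy Jacobian $H=\partial q/\partial v$ satisfies $$H=(\widehat RT)(\widehat RT)^T=\widehat R\,Z\,\widehat R^T .$$ Moreover, with $\widehat R$, $Z$ and the eigenvalue matrix $\Lambda$ evaluated at a mean state at the interface, the numerical flux $$\hat f^{\rm KEPES}=\hat f^{\rm KEPEC}-\tfrac12\,\widehat R\,|\Lambda|\,Z\,\widehat R^T[\![v]\!]$$ is entropy stable, i.e. the semi-discrete finite volume scheme with this interface flux satisfies $$\frac{\partial}{\partial t}\left(\Delta x_LS_L+\Delta x_RS_R\right)+[\![F]\!]\le 0 .$$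
   Context: States. A state is given by density $\rho>0$, velocity $\vec u=(u,v,w)$, pressure $p>0$, magnetic field $\vec B=(B_1,B_2,B_3)$; $\gamma>1$. Conserved variables $q=(\rho,\rho u,\rho v,\rho w,E,B_1,B_2,B_3)^T$, $E=\frac{p}{\gamma-1}+\frac\rho2\|\vec u\|^2+\frac12\|\vec B\|^2$. Physical flux in $x$: $$f=\Big(\rho u,\ \rho u^2+p+\tfrac12\|\vec B\|^2-B_1^2,\ \rho uv-B_1B_2,\ \rho uw-B_1B_3,\ u\big(\tfrac\rho2\|\vec u\|^2+\tfrac{\gamma p}{\gamma-1}+\|\vec B\|^2\big)-B_1(\vec u\cdot\vec B),\ 0,\ uB_2-vB_1,\ uB_3-wB_1\Big)^T.$$ Entropy. $s=\ln p-\gamma\ln\rho$, $S=-\frac{\rho s}{\gamma-1}$, $F=uS$, $\beta=\frac{\rho}{2p}$, entropy variables $v=\partial S/\partial q=\big(\tfrac{\gamma-s}{\gamma-1}-\beta\|\vec u\|^2,2\beta u,2\beta v,2\beta w,-2\beta,2\beta B_1,2\beta B_2,2\beta B_3\big)^T$, and $H=\partial q/\partial v$ (the inverse Hessian of $S$ in $q$). Eigenstructure. The Powell-augmented flux Jacobian is $\partial f/\partial q+P$, where $P$ is the $8\times8$ matrix whose only nonzero column is the sixth, equal to $(0,B_1,B_2,B_3,\vec u\cdot\vec B,u,v,w)^T$. Let $$a^2=\gamma p/\rho,\quad b_k=B_k/\sqrt\rho,\quad b^2=b_1^2+b_2^2+b_3^2,\quad b_\perp=\sqrt{b_2^2+b_3^2}>0,\quad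 \beta_k=b_k/b_\perp,$$ $$c_{f,s}^2=\tfrac12\Big((a^2+b^2)\pm\sqrt{(a^2+b^2)^2-4a^2b_1^2}\Big)\ (+\text{ for }f,\ -\text{ for }s),\quad \alpha_f^2=\frac{a^2-c_s^2}{c_f^2-c_s^2},\quad \alpha_s^2=\frac{c_f^2-a^2}{c_f^2-c_s^2},$$ with $a,c_f,c_s,\alpha_f,\alpha_s\ge0$, and $\sigma(\omega)=1$ if $\omega\ge0$, $\sigma(\omega)=-1$ otherwise. Set $$\Psi_{\pm s}=\tfrac{\alpha_s\rho\|\vec u\|^2}{2}-a\alpha_f\rho b_\perp+\tfrac{\alpha_s\rho a^2}{\gamma-1}\pm\alpha_sc_s\rho u\pm\alpha_fc_f\rho\,\sigma(b_1)(v\beta_2+w\beta_3),$$ $$\Psi_{\pm f}=\tfrac{\alpha_f\rho\|\vec u\|^2}{2}+a\alpha_s\rho b_\perp+\tfrac{\alpha_f\rho a^2}{\gamma-1}\pm\alpha_fc_f\rho u\mp\alpha_sc_s\rho\,\sigma(b_1)(v\beta_2+w\beta_3).$$ Then $\widehat R=[\hat r_{+f}|\hat r_{+a}|\hat r_{+s}|\hat r_E|\hat r_D|\hat r_{-s}|\hat r_{-a}|\hat r_{-f}]$ with $$\hat r_E=(1,u,v,w,\tfrac{\|\vec u\|^2}{2},0,0,0)^T,\qquad \hat r_D=(0,0,0,0,B_1,1,0,0)^T,$$ $$\hat r_{\pm a}=\big(0,0,\pm\rho^{3/2}\beta_3,\mp\rho^{3/2}\beta_2,\mp\rho^{3/2}(\beta_2w-\beta_3v),0,-\rho\beta_3,\rho\beta_2\big)^T,$$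 $$\hat r_{\pm f}=\big(\alpha_f\rho,\ \alpha_f\rho(u\pm c_f),\ \rho(\alpha_fv\mp\alpha_sc_s\beta_2\sigma(b_1)),\ \rho(\alpha_fw\mp\alpha_sc_s\beta_3\sigma(b_1)),\ \Psi_{\pm f},\ 0,\ \alpha_sa\beta_2\sqrt\rho,\ \alpha_sa\beta_3\sqrt\rho\big)^T,$$ $$\hat r_{\pm s}=\big(\alpha_s\rho,\ \alpha_s\rho(u\pm c_s),\ \rho(\alpha_sv\pm\alpha_fc_f\beta_2\sigma(b_1)),\ \rho(\alpha_sw\pm\alpha_fc_f\beta_3\sigma(b_1)),\ \Psi_{\pm s},\ 0,\ -\alpha_fa\beta_2\sqrt\rho,\ -\alpha_fa\beta_3\sqrt\rho\big)^T,$$ and $\Lambda=\mathrm{diag}(u+c_f,\ u+b_1,\ u+c_s,\ u,\ u,\ u-c_s,\ u-b_1,\ u-c_f)$; $|\Lambda|$ is the entrywise absolute value. ''Mean state'' means any admissible state with $\rho,p>0$, $b_\perp>0$. Averages. At an interface between states $L,R$ with cell widths $\Delta x_L,\Delta x_R>0$: $[\![a]\!]=a_R-a_L$, $\{\!\{a\}\!\}=\frac12(a_L+a_R)$, $a^{\ln}=\frac{a_L-a_R}{\ln a_L-\ln a_R}$ for positive $a$ (the common value if $a_L=a_R$). Scheme. With numerical flux $\hat f$: $$\Delta x_L\partial_tq_L=f_L-\hat f+\tfrac12\Delta x_L\,s_{\rm interface},\qquad \Delta x_R\partial_tq_R=\hat f-f_R+\tfrac12\Delta x_R\,s_{\rm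 interface},$$ $$s_{\rm interface}=-[\![B_1]\!]\left[0,0,0,0,0,\{\!\{u\}\!\}\tfrac{\{\!\{\beta\}\!\}\{\!\{B_1\}\!\}}{\{\!\{\Delta x\beta B_1\}\!\}},\{\!\{v\}\!\}\tfrac{\{\!\{\beta\}\!\}\{\!\{B_2\}\!\}}{\{\!\{\Delta x\beta B_2\}\!\}},\{\!\{w\}\!\}\tfrac{\{\!\{\beta\}\!\}\{\!\{B_3\}\!\}}{\{\!\{\Delta x\beta B_3\}\!\}}\right]^T$$ (denominators assumed nonzero), and $\partial_tS_{L,R}=v_{L,R}^T\partial_tq_{L,R}$. The flux $\hat f^{\rm KEPEC}=(\hat f_1,\dots,\hat f_8)^T$ is $$\hat f_1=\rho^{\ln}\{\!\{u\}\!\},\quad \hat f_2=\rho^{\ln}\{\!\{u\}\!\}^2+\tfrac{\{\!\{\rho\}\!\}}{2\{\!\{\beta\}\!\}}+\tfrac12\big(\{\!\{B_1^2\}\!\}+\{\!\{B_2^2\}\!\}+\{\!\{B_3^2\}\!\}\big)-\{\!\{B_1^2\}\!\},$$ $$\hat f_3=\rho^{\ln}\{\!\{u\}\!\}\{\!\{v\}\!\}-\{\!\{B_1B_2\}\!\},\quad \hat f_4=\rho^{\ln}\{\!\{u\}\!\}\{\!\{w\}\!\}-\{\!\{B_1B_3\}\!\},\quad \hat f_6=0,$$ $$\hat f_7=\{\!\{u\}\!\}\{\!\{B_2\}\!\}-\{\!\{v\}\!\}\{\!\{B_1\}\!\},\quad \hat f_8=\{\!\{u\}\!\}\{\!\{B_3\}\!\}-\{\!\{w\}\!\}\{\!\{B_1\}\!\},$$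 $$\begin{aligned}\hat f_5={}&\tfrac{\{\!\{u\}\!\}}{2}\Big(\tfrac{\rho^{\ln}}{\beta^{\ln}(\gamma-1)}+\tfrac{\{\!\{\rho\}\!\}}{\{\!\{\beta\}\!\}}\Big)+\tfrac{\rho^{\ln}\{\!\{u\}\!\}}{2}\Big(2(\{\!\{u\}\!\}^2+\{\!\{v\}\!\}^2+\{\!\{w\}\!\}^2)-(\{\!\{u^2\}\!\}+\{\!\{v^2\}\!\}+\{\!\{w^2\}\!\})\Big)\\&+\tfrac{\{\!\{u\}\!\}}{2}\Big(\{\!\{B_1^2\}\!\}+\{\!\{B_2^2\}\!\}+\{\!\{B_3^2\}\!\}+2[\{\!\{B_2\}\!\}^2+\{\!\{B_3\}\!\}^2]\Big)-\{\!\{u\}\!\}\{\!\{B_1^2\}\!\}-\{\!\{v\}\!\}\{\!\{B_1B_2\}\!\}-\{\!\{w\}\!\}\{\!\{B_1B_3\}\!\}\\&-\{\!\{v\}\!\}\{\!\{B_1\}\!\}\{\!\{B_2\}\!\}-\{\!\{w\}\!\}\{\!\{B_1\}\!\}\{\!\{B_3\}\!\}+\{\!\{uB_1^2\}\!\}+\{\!\{vB_1B_2\}\!\}+\{\!\{wB_1B_3\}\!\}-\tfrac12\big(\{\!\{uB_1^2\}\!\}+\{\!\{uB_2^2\}\!\}+\{\!\{uB_3^2\}\!\}\big).\end{aligned}$$ *)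

(* Defs.v *)
From HB Require Import structures.
From mathcomp Require Import all_boot all_order all_algebra.
From mathcomp Require Import ring.
From mathcomp Require Import all_classical all_reals all_analysis.

Set Implicit Arguments.
Unset Strict Implicit.
Unset Printing Implicit Defensive.

Import Order.TTheory GRing.Theory Num.Theory.
Import numFieldNormedType.Exports.
Local Open Scope ring_scope.

(** Entropy stable fluxes for the ideal MHD equations, in MathComp-Analysis
    over an arbitrary [R : realType].  Vectors of R^8 are column vectors. *)

(** Primitive variables: density, velocity (u, v, w), pressure, magnetic field. *)
Record state (R : realType) := State {
  rho : R; u : R; v : R; w : R; p : R; B1 : R; B2 : R; B3 : R }.
Arguments rho {R} _.
Arguments u {R} _.
Arguments v {R} _.
Arguments w {R} _.
Arguments p {R} _.
Arguments B1 {R} _.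
Arguments B2 {R} _.
Arguments B3 {R} _.

Definition admissible (R : realType) (X : state R) : Prop :=
  0 < rho X /\ 0 < p X.

Definition vec8 (R : realType) (s : seq R) : 'cV[R]_8 := \col_(i < 8) s`_i.

Section Equations.
Variables (R : realType) (gamma : R).
Implicit Types (X : state R) (q : 'cV[R]_8).

Definition usq X : R := u X ^+ 2 + v X ^+ 2 + w X ^+ 2.
Definition Bsq X : R := B1 X ^+ 2 + B2 X ^+ 2 + B3 X ^+ 2.
Definition udotB X : R := u X * B1 X + v X * B2 X + w X * B3 X.

Definition energy X : R :=
  p X / (gamma - 1) + rho X / 2 * usq X + 2^-1 * Bsq X.

Definition cons X : 'cV[R]_8 :=
  vec8 [:: rho X; rho X * u X; rho X * v X; rho X * w X; energy X;
           B1 X; B2 X; B3 X].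

(** Inverse of [cons] on states of nonzero density, see [consK] and [primK]. *)
Definition prim q : state R :=
  let c k := q (inord k) 0 in
  let vx := c 1%N / c 0%N in let vy := c 2%N / c 0%N in let vz := c 3%N / c 0%N in
  State (c 0%N) vx vy vz
    ((gamma - 1) *
       (c 4%N - c 0%N / 2 * (vx ^+ 2 + vy ^+ 2 + vz ^+ 2)
            - 2^-1 * (c 5%N ^+ 2 + c 6%N ^+ 2 + c 7%N ^+ 2)))
    (c 5%N) (c 6%N) (c 7%N).

Definition flux X : 'cV[R]_8 :=
  vec8 [:: rho X * u X;
           rho X * u X ^+ 2 + p X + 2^-1 * Bsq X - B1 X ^+ 2;
           rho X * u X * v X - B1 X * B2 X;
           rho X * u X * w X - B1 X * B3 X;
           u X * (rho X / 2 * usq X + gamma * p X / (gamma - 1) + Bsq X)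
             - B1 X * udotB X;
           0;
           u X * B2 X - v X * B1 X;
           u X * B3 X - w X * B1 X].

(** ** Entropy *)

Definition phys_entropy X : R := ln (p X) - gamma * ln (rho X).

Definition entropy X : R := - (rho X * phys_entropy X) / (gamma - 1).

Definition entropy_flux X : R := u X * entropy X.

Definition beta X : R := rho X / (2 * p X).

Definition entropy_cons q : R := entropy (prim q).

Definition gradient (f : 'cV[R]_8 -> R) q : 'cV[R]_8 :=
  \col_(i < 8) 'D_(delta_mx i 0) f q.

Definition hessian (f : 'cV[R]_8 -> R) q : 'M[R]_8 :=
  \matrix_(i < 8, j < 8) 'D_(delta_mx j 0) (fun q' => gradient f q' i 0) q.

(** The entropy variables dS/dq; in closed form
    ((gamma - s) / (gamma - 1) - beta |u|^2, 2 beta u, 2 beta v, 2 beta w,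
    - 2 beta, 2 beta B1, 2 beta B2, 2 beta B3) with s = [phys_entropy]. *)
Definition entropy_var X : 'cV[R]_8 := gradient entropy_cons (cons X).

Definition entropy_hessian X : 'M[R]_8 := hessian entropy_cons (cons X).

(** H = dq/dv.  [invmx] is the identity on singular matrices, so this is
    meaningful only together with [entropy_hessian X \in unitmx]. *)
Definition entropy_jacobian X : 'M[R]_8 := invmx (entropy_hessian X).

(** ** Eigenstructure of the Powell-augmented flux Jacobian *)

Definition sound X : R := Num.sqrt (gamma * p X / rho X).
Definition b1 X : R := B1 X / Num.sqrt (rho X).
Definition b2 X : R := B2 X / Num.sqrt (rho X).
Definition b3 X : R := B3 X / Num.sqrt (rho X).
Definition bsq X : R := b1 X ^+ 2 + b2 X ^+ 2 + b3 X ^+ 2.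
Definition bperp X : R := Num.sqrt (b2 X ^+ 2 + b3 X ^+ 2).
Definition beta2 X : R := b2 X / bperp X.
Definition beta3 X : R := b3 X / bperp X.

Definition discr X : R :=
  (sound X ^+ 2 + bsq X) ^+ 2 - 4 * sound X ^+ 2 * b1 X ^+ 2.
Definition cfast X : R :=
  Num.sqrt (2^-1 * ((sound X ^+ 2 + bsq X) + Num.sqrt (discr X))).
Definition cslow X : R :=
  Num.sqrt (2^-1 * ((sound X ^+ 2 + bsq X) - Num.sqrt (discr X))).

Definition alphaf X : R :=
  Num.sqrt ((sound X ^+ 2 - cslow X ^+ 2) / (cfast X ^+ 2 - cslow X ^+ 2)).
Definition alphas X : R :=
  Num.sqrt ((cfast X ^+ 2 - sound X ^+ 2) / (cfast X ^+ 2 - cslow X ^+ 2)).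

Definition sgn0 (x : R) : R := if 0 <= x then 1 else -1.

(** The parameter [e] of [Psi_s], [Psi_f], [rhat_a], [rhat_f] and [rhat_s] is
    the sign of the wave, 1 or -1. *)
Definition Psi_s (e : R) X : R :=
  alphas X * rho X * usq X / 2 - sound X * alphaf X * rho X * bperp X
  + alphas X * rho X * sound X ^+ 2 / (gamma - 1)
  + e * (alphas X * cslow X * rho X * u X)
  + e * (alphaf X * cfast X * rho X * sgn0 (b1 X)
         * (v X * beta2 X + w X * beta3 X)).

Definition Psi_f (e : R) X : R :=
  alphaf X * rho X * usq X / 2 + sound X * alphas X * rho X * bperp X
  + alphaf X * rho X * sound X ^+ 2 / (gamma - 1)
  + e * (alphaf X * cfast X * rho X * u X)
  - e * (alphas X * cslow X * rho X * sgn0 (b1 X)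
         * (v X * beta2 X + w X * beta3 X)).

Definition rhat_E X : 'cV[R]_8 :=
  vec8 [:: 1; u X; v X; w X; usq X / 2; 0; 0; 0].

Definition rhat_D X : 'cV[R]_8 := vec8 [:: 0; 0; 0; 0; B1 X; 1; 0; 0].

Definition rhat_a (e : R) X : 'cV[R]_8 :=
  let r32 := rho X `^ (3 / 2) in
  vec8 [:: 0; 0; e * (r32 * beta3 X); - (e * (r32 * beta2 X));
           - (e * (r32 * (beta2 X * w X - beta3 X * v X)));
           0; - (rho X * beta3 X); rho X * beta2 X].

Definition rhat_f (e : R) X : 'cV[R]_8 :=
  vec8 [:: alphaf X * rho X;
           alphaf X * rho X * (u X + e * cfast X);
           rho X * (alphaf X * v X
                    - e * (alphas X * cslow X * beta2 X * sgn0 (b1 X)));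
           rho X * (alphaf X * w X
                    - e * (alphas X * cslow X * beta3 X * sgn0 (b1 X)));
           Psi_f e X;
           0;
           alphas X * sound X * beta2 X * Num.sqrt (rho X);
           alphas X * sound X * beta3 X * Num.sqrt (rho X)].

Definition rhat_s (e : R) X : 'cV[R]_8 :=
  vec8 [:: alphas X * rho X;
           alphas X * rho X * (u X + e * cslow X);
           rho X * (alphas X * v X
                    + e * (alphaf X * cfast X * beta2 X * sgn0 (b1 X)));
           rho X * (alphas X * w X
                    + e * (alphaf X * cfast X * beta3 X * sgn0 (b1 X)));
           Psi_s e X;
           0;
           - (alphaf X * sound X * beta2 X * Num.sqrt (rho X));
           - (alphaf X * sound X * beta3 X * Num.sqrt (rho X))].

Definition Rhat X : 'M[R]_8 :=
  \matrix_(i < 8, j < 8)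
    ([:: rhat_f 1 X; rhat_a 1 X; rhat_s 1 X; rhat_E X; rhat_D X; rhat_s (-1) X; rhat_a (-1) X; rhat_f (-1) X]`_j
       : 'cV[R]_8) i 0.

Definition diag8 (s : seq R) : 'M[R]_8 := diag_mx (\row_(i < 8) s`_i).

Definition Lambda X : 'M[R]_8 :=
  diag8 [:: u X + cfast X; u X + b1 X; u X + cslow X; u X; u X;
            u X - cslow X; u X - b1 X; u X - cfast X].

Definition absLambda X : 'M[R]_8 := map_mx Num.norm (Lambda X).

Definition Tscal X : 'M[R]_8 :=
  let t := 1 / Num.sqrt (2 * rho X * gamma) in
  let ta := Num.sqrt (p X / (2 * rho X ^+ 3)) in
  diag8 [:: t; ta; t; Num.sqrt (rho X * (gamma - 1) / gamma);
            Num.sqrt (p X / rho X); t; ta; t].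

Definition Zscal X : 'M[R]_8 := Tscal X ^+ 2.

(** ** Two-point averages *)

Definition avg (a b : R) : R := 2^-1 * (a + b).

Definition lnmean (a b : R) : R := if a == b then a else (a - b) / (ln a - ln b).

(** ** Numerical fluxes and the semi-discrete scheme *)

Definition flux_KEPEC (XL XR : state R) : 'cV[R]_8 :=
  let m (g : state R -> R) := avg (g XL) (g XR) in
  let rln := lnmean (rho XL) (rho XR) in
  let betaln := lnmean (beta XL) (beta XR) in
  vec8 [::
    rln * m u;
    rln * m u ^+ 2 + m rho / (2 * m beta)
      + 2^-1 * (m (fun X => B1 X ^+ 2) + m (fun X => B2 X ^+ 2)
                + m (fun X => B3 X ^+ 2))
      - m (fun X => B1 X ^+ 2);
    rln * m u * m v - m (fun X => B1 X * B2 X);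
    rln * m u * m w - m (fun X => B1 X * B3 X);
    m u / 2 * (rln / (betaln * (gamma - 1)) + m rho / m beta)
      + rln * m u / 2
        * (2 * (m u ^+ 2 + m v ^+ 2 + m w ^+ 2)
           - (m (fun X => u X ^+ 2) + m (fun X => v X ^+ 2)
              + m (fun X => w X ^+ 2)))
      + m u / 2
        * (m (fun X => B1 X ^+ 2) + m (fun X => B2 X ^+ 2)
           + m (fun X => B3 X ^+ 2) + 2 * (m B2 ^+ 2 + m B3 ^+ 2))
      - m u * m (fun X => B1 X ^+ 2)
      - m v * m (fun X => B1 X * B2 X)
      - m w * m (fun X => B1 X * B3 X)
      - m v * m B1 * m B2 - m w * m B1 * m B3
      + m (fun X => u X * B1 X ^+ 2) + m (fun X => v X * B1 X * B2 X)
      + m (fun X => w X * B1 X * B3 X)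
      - 2^-1 * (m (fun X => u X * B1 X ^+ 2) + m (fun X => u X * B2 X ^+ 2)
                + m (fun X => u X * B3 X ^+ 2));
    0;
    m u * m B2 - m v * m B1;
    m u * m B3 - m w * m B1].

Definition flux_KEPES (XM XL XR : state R) : 'cV[R]_8 :=
  flux_KEPEC XL XR
  - 2^-1 *: (Rhat XM *m absLambda XM *m Zscal XM *m (Rhat XM)^T
             *m (entropy_var XR - entropy_var XL)).

(** The average of (cell width) * beta * g. *)
Definition avg_dxbeta (dxL dxR : R) (XL XR : state R) (g : state R -> R) : R :=
  avg (dxL * beta XL * g XL) (dxR * beta XR * g XR).

Definition source_defined (dxL dxR : R) (XL XR : state R) : Prop :=
  [/\ avg_dxbeta dxL dxR XL XR B1 != 0, avg_dxbeta dxL dxR XL XR B2 != 0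
    & avg_dxbeta dxL dxR XL XR B3 != 0].

Definition s_interface (dxL dxR : R) (XL XR : state R) : 'cV[R]_8 :=
  let m (g : state R -> R) := avg (g XL) (g XR) in
  let d := avg_dxbeta dxL dxR XL XR in
  - (B1 XR - B1 XL) *:
  vec8 [:: 0; 0; 0; 0; 0;
           m u * (m beta * m B1 / d B1);
           m v * (m beta * m B2 / d B2);
           m w * (m beta * m B3 / d B3)].

(** The cell states [XL], [XR] (functions of time) obey at time [t] the
    semi-discrete scheme with interface flux [fhat]. *)
Definition scheme (fhat : state R -> state R -> 'cV[R]_8) (dxL dxR : R)
    (XL XR : R -> state R) (t : R) : Prop :=
  let qL := fun tau : R => cons (XL tau) in
  let qR := fun tau : R => cons (XR tau) in
  let src := s_interface dxL dxR (XL t) (XR t) in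
  [/\ derivable qL t 1, derivable qR t 1,
      dxL *: derive1 qL t
        = flux (XL t) - fhat (XL t) (XR t) + (2^-1 * dxL) *: src
    & dxR *: derive1 qR t
        = fhat (XL t) (XR t) - flux (XR t) + (2^-1 * dxR) *: src].

Lemma consK X : gamma != 1 -> rho X != 0 -> prim (cons X) = X.
Proof.
move=> g1 r0; have g10 : gamma - 1 != 0 by rewrite subr_eq0.
rewrite /prim !mxE !inordK //= /energy /usq /Bsq.
case: X r0 => /= a b c d e f g h a0; congr State.
all: by field; rewrite ?a0 ?g10.
Qed.

Lemma primK q : gamma != 1 -> q 0 0 != 0 -> cons (prim q) = q.
Proof.
move=> g1 q0; have g10 : gamma - 1 != 0 by rewrite subr_eq0.
have c0 : q (inord 0) 0 != 0.
  by rewrite (_ : inord 0 = 0) //; apply/val_inj; rewrite /= inordK.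
apply/colP => i; rewrite mxE -[in RHS](inord_val i).
case: i; do 8?[case=> [|]] => //= _; rewrite ?inordK /energy /usq /Bsq //=; field.
all: by rewrite ?c0 ?g10.
Qed.

End Equations.

(* Main.v *)
Require Import Defs.
From mathcomp Require Import all_boot all_order all_algebra.
From mathcomp Require Import ring lra.
From mathcomp Require Import all_classical all_reals all_analysis.

Set Implicit Arguments.
Unset Strict Implicit.
Unset Printing Implicit Defensive.

Import Order.TTheory GRing.Theory Num.Theory.
Import numFieldNormedType.Exports.
Local Open Scope ring_scope.

(** Factorization of H.  In the conserved variables the Hessian of the entropy
    is dense, but it becomes diagonal in the coordinates
    (d rho, d u, d v, d w, d ln beta, d B) of a direction:
    [entropy_hessian_factor] writes it as N^T D N with D the diagonal of
    positive weights [entropy_weight].  In these coordinates the eigenvectors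
    are sparse and no longer involve the velocity, and the lemmas
    [entropy_form_ff] to [entropy_form_ED] show that they are pairwise
    orthogonal for the Hessian.  For the fast and slow waves this rests on
    alphaf^2 + alphas^2 = 1, alphaf^2 cf^2 + alphas^2 cs^2 = a^2,
    beta2^2 + beta3^2 = 1 and 2 beta a^2 = gamma.  The entries of T are the
    inverse lengths of the eigenvectors, so Y = R T satisfies
    Y^T (Hess S) Y = 1.  As Y is square, this says that Hess S is invertible
    with inverse Y Y^T, that is H = (R T) (R T)^T = R Z R^T.

    Entropy stability.  By the chain rule ([entropy_rate]) the entropy
    production at the interface is an affine expression in the interface flux.
    Write J for the jump across the interface.  The work J(v) . f of the
    baseline flux is J(psi), where psi = v . f - F at each of the two states, up
    to a multiple of J(B1) ([KEPEC_jump]), and the interface source term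
    produces exactly the opposite of this multiple ([source_work]).  Hence for
    any interface flux the production is J(v) . g with g the deviation from the
    baseline flux ([scheme_entropy_rate]).  For the stable flux g is
    - R |Lambda| Z R^T J(v) / 2, and J(v) . g is then minus half a sum of
    squares with the nonnegative weights |lambda_i| ([dissipation_ge0]). *)

(** * Vectors of length eight *)

Section Vectors.
Variable R : realType.
Implicit Types (c : R) (x y z : 'cV[R]_8).

Lemma sum_inord8 (F : 'I_8 -> R) :
  \sum_i F i = F (inord 0) + F (inord 1) + F (inord 2) + F (inord 3)
    + F (inord 4) + F (inord 5) + F (inord 6) + F (inord 7).
Proof.
rewrite (eq_bigr (fun i : 'I_8 => F (inord i))) => [|i _]; last by rewrite inord_val.
by rewrite !big_ord_recr big_ord0 /= add0r.
Qed.

Lemma ordinal8_ind (P : 'I_8 -> Prop) :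
  P (inord 0) -> P (inord 1) -> P (inord 2) -> P (inord 3) ->
  P (inord 4) -> P (inord 5) -> P (inord 6) -> P (inord 7) -> forall i, P i.
Proof.
move=> P0 P1 P2 P3 P4 P5 P6 P7 i; rewrite -[i]inord_val.
by case: i; do 8?[case=> [|]].
Qed.

Definition dot x y : R := \sum_i x i 0 * y i 0.

Lemma dotDl x y z : dot (x + y) z = dot x z + dot y z.
Proof. by rewrite -big_split; apply: eq_bigr => i _; rewrite mxE mulrDl. Qed.

Lemma dotC x y : dot x y = dot y x.
Proof. by apply: eq_bigr => i _; rewrite mulrC. Qed.

Lemma dotDr x y z : dot x (y + z) = dot x y + dot x z.
Proof. by rewrite !(dotC x) dotDl. Qed.

Lemma dotZr c x y : dot x (c *: y) = c * dot x y.
Proof. by rewrite mulr_sumr; apply: eq_bigr => i _; rewrite mxE mulrCA. Qed.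

Lemma dotNr x y : dot x (- y) = - dot x y.
Proof. by rewrite -scaleN1r dotZr mulN1r. Qed.

Lemma dotNl x y : dot (- x) y = - dot x y.
Proof. by rewrite dotC dotNr dotC. Qed.

End Vectors.

(** * Differentiating along a curve of states *)

Section Derivatives.
Variable R : realType.
Implicit Types (f g : R -> R) (t a b : R).

(** The differentiation rules, restated on explicit lambda abstractions: this
    is the form taken by the entries of a curve of states, and [derive_step]
    selects a rule by the head of the body. *)
Lemma is_derive_lamC t a : is_derive t 1 (fun=> a) 0.
Proof. exact: is_derive_cst. Qed.

Lemma is_derive_lam_id t : is_derive t 1 (fun x : R => x) 1.
Proof. exact: is_derive_id. Qed.

Lemma is_derive_lamD f g t a b : is_derive t 1 f a -> is_derive t 1 g b ->
  is_derive t 1 (fun x => f x + g x) (a + b).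
Proof. exact: is_deriveD. Qed.

Lemma is_derive_lamN f t a : is_derive t 1 f a ->
  is_derive t 1 (fun x => - f x) (- a).
Proof. exact: is_deriveN. Qed.

Lemma is_derive_lamM f g t a b : is_derive t 1 f a -> is_derive t 1 g b ->
  is_derive t 1 (fun x => f x * g x) (f t * b + g t * a).
Proof. exact: is_deriveM. Qed.

Lemma is_derive_lam_sqr f t a : is_derive t 1 f a ->
  is_derive t 1 (fun x => f x ^+ 2) (2 * f t * a).
Proof.
move=> fa; have := is_derive_lamM fa fa.
by rewrite [X in is_derive _ _ _ X -> _](_ : _ = 2 * f t * a); last ring.
Qed.

Lemma is_derive_lamV f t a : f t != 0 -> is_derive t 1 f a ->
  is_derive t 1 (fun x => (f x)^-1) (- (f t) ^- 2 * a).
Proof. exact: is_deriveV. Qed.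

Lemma is_derive_lam_ln f t a : 0 < f t -> is_derive t 1 f a ->
  is_derive t 1 (fun x => ln (f x)) ((f t)^-1 * a).
Proof. by move=> f0 fa; apply: is_derive1_comp; exact: is_derive1_ln. Qed.

Lemma is_derive_near_gt0 f t a : is_derive t 1 f a -> 0 < f t ->
  \forall x \near t, 0 < f x.
Proof.
move=> [/derivable1_diffP/differentiable_continuous fc _] f0.
exact: (cvgr_gt (f t) fc 0 f0).
Qed.

End Derivatives.

Ltac derive_step := first
  [ eassumption
  | notypeclasses refine (is_derive_lam_id _)
  | notypeclasses refine (is_derive_lamC _ _)
  | notypeclasses refine (is_derive_lamD _ _)
  | notypeclasses refine (is_derive_lamN _)
  | notypeclasses refine (is_derive_lam_sqr _)
  | notypeclasses refine (is_derive_lamM _ _)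
  | notypeclasses refine (is_derive_lam_ln _ _)
  | notypeclasses refine (is_derive_lamV _ _) ].

(** Replaces a claim [is_derive t 1 f a] by the equation between [a] and the
    derivative computed from the hypotheses.  Class resolution is disabled so
    that the intermediate derivatives stay undetermined until [derive_step]
    fixes them. *)
Ltac derive_with :=
  notypeclasses refine (is_derive_eq _ _); [by do ! derive_step | cbv beta].

Section Calculus.
Variables (R : realType) (gamma : R).
Hypothesis gamma_gt1 : 1 < gamma.
Implicit Types (X T : state R) (q d : 'cV[R]_8).

Definition state_is_derive (Y : R -> state R) (t : R) T : Prop :=
  is_derive t 1 (fun x => rho (Y x)) (rho T) /\
  is_derive t 1 (fun x => u (Y x)) (u T) /\
  is_derive t 1 (fun x => v (Y x)) (v T) /\
  is_derive t 1 (fun x => w (Y x)) (w T) /\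
  is_derive t 1 (fun x => p (Y x)) (p T) /\
  is_derive t 1 (fun x => B1 (Y x)) (B1 T) /\
  is_derive t 1 (fun x => B2 (Y x)) (B2 T) /\
  is_derive t 1 (fun x => B3 (Y x)) (B3 T).

(** The differential at [cons X] of the map [prim], in the direction [d]; the
    resulting rates of change of the primitive variables are stored in a
    [state], which need not be admissible. *)
Definition tangent X d : state R :=
  let c k := d (inord k) 0 in
  State (c 0%N) ((c 1%N - u X * c 0%N) / rho X)
    ((c 2%N - v X * c 0%N) / rho X) ((c 3%N - w X * c 0%N) / rho X)
    ((gamma - 1) * (c 4%N - (u X * c 1%N + v X * c 2%N + w X * c 3%N)
       + usq X / 2 * c 0%N - (B1 X * c 5%N + B2 X * c 6%N + B3 X * c 7%N)))
    (c 5%N) (c 6%N) (c 7%N).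

Lemma prim_derive (Q : R -> 'cV[R]_8) (t : R) d :
    (forall i, is_derive t 1 (fun x => Q x i 0) (d i 0)) ->
    rho (prim gamma (Q t)) != 0 ->
  state_is_derive (fun x => prim gamma (Q x)) t (tangent (prim gamma (Q t)) d).
Proof.
rewrite /= => dQ r0.
have [] := (dQ (inord 0), dQ (inord 1)).
move: (dQ (inord 2)) (dQ (inord 3)) (dQ (inord 4)) => d2 d3 d4.
move: (dQ (inord 5)) (dQ (inord 6)) (dQ (inord 7)) => d5 d6 d7 d0 d1.
rewrite /state_is_derive /tangent /usq /=.
notypeclasses refine (conj _ (conj _ (conj _ (conj _ (conj _ (conj _ (conj _ _))))))) => //.
all: [> derive_with ..].
all: by field.
Qed.

Definition entropy_var_formula X : 'cV[R]_8 :=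
  vec8 [:: (gamma - phys_entropy gamma X) / (gamma - 1) - beta X * usq X;
           2 * beta X * u X; 2 * beta X * v X; 2 * beta X * w X; - (2 * beta X);
           2 * beta X * B1 X; 2 * beta X * B2 X; 2 * beta X * B3 X].

(** Coordinates of a direction [d] in which the second derivative of the
    entropy is diagonal: the rates of change of rho, of the velocity, of
    ln beta (the fifth entry, since beta = rho / (2 p)) and of the magnetic
    field. *)
Definition entropy_coord X d : 'cV[R]_8 :=
  let T := tangent X d in
  vec8 [:: rho T; u T; v T; w T; rho T / rho X - p T / p X; B1 T; B2 T; B3 T].

Definition entropy_weight X : 'rV[R]_8 :=
  \row_(i < 8) [:: (rho X)^-1; 2 * beta X * rho X; 2 * beta X * rho X;
    2 * beta X * rho X; rho X / (gamma - 1); 2 * beta X; 2 * beta X;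
    2 * beta X]`_i.

(** Second derivative of the entropy with respect to the conserved variables,
    see [entropy_hessianE]. *)
Definition entropy_form X d d' : R :=
  \sum_i entropy_weight X 0 i * entropy_coord X d i 0 * entropy_coord X d' i 0.

(** The relation dS = v . dq.  Only the value and the rate of change of the
    primitive variables at time [t] matter, so the lemma serves both the partial
    derivatives and the evolution in time. *)
Lemma entropy_derive (Y : R -> state R) (t : R) d :
    admissible (Y t) -> state_is_derive Y t (tangent (Y t) d) ->
  is_derive t 1 (fun x => entropy gamma (Y x))
    (dot (entropy_var_formula (Y t)) d).
Proof.
move=> [r0 p0] [] dr [] du [] dv [] dw [] dp [] d1 [] d2 d3.
rewrite /entropy /phys_entropy; derive_with.
rewrite /dot sum_inord8 !mxE !inordK //= /phys_entropy /beta /usq.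
field; rewrite ?(gt_eqF r0) ?(gt_eqF p0) ?subr_eq0 ?(gt_eqF gamma_gt1) //.
Qed.

(** In primitive variables the entropy variables are elementary functions; the
    computation of their rate of change shows that the Hessian is diagonal in
    the coordinates [entropy_coord]. *)
Lemma entropy_var_derive (Y : R -> state R) (t : R) d i :
    admissible (Y t) -> state_is_derive Y t (tangent (Y t) d) ->
  is_derive t 1 (fun x => entropy_var_formula (Y x) i 0)
    (entropy_form (Y t) (delta_mx i 0) d).
Proof.
move=> [r0 p0] [] dr [] du [] dv [] dw [] dp [] d1 [] d2 d3.
under eq_fun do rewrite mxE.
have p20 : 2 * p (Y t) != 0 by rewrite mulf_neq0 ?pnatr_eq0 ?gt_eqF.
elim/ordinal8_ind: i.
all: rewrite !inordK //= /entropy_form sum_inord8 !mxE !inordK //= !mxE.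
all: rewrite -!val_eqE /= !inordK //= /phys_entropy /beta /usq.
all: [> derive_with ..].
all: rewrite /tangent /usq /=.
all: field; rewrite ?(gt_eqF r0) ?(gt_eqF p0) ?subr_eq0 ?(gt_eqF gamma_gt1) //.
Qed.

End Calculus.

(** * The Hessian of the entropy *)

Section Hessian.
Variables (R : realType) (gamma : R).
Hypothesis gamma_gt1 : 1 < gamma.
Implicit Types (X T : state R) (q d : 'cV[R]_8).

Lemma derive_along_line (f : 'cV[R]_8 -> R) q d (a : R) :
  is_derive (0 : R) 1 (fun h => f (h *: d + q)) a -> 'D_d f q = a.
Proof.
case=> _ <-; rewrite /derive.
set g1 := fun h => h^-1 *: _; set g2 := fun h => h^-1 *: _.
suff -> : g1 = g2 by [].
by apply/funext => h; rewrite /g1 /g2 /= addr0 scale0r add0r [h%:A]mulr1.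
Qed.

Lemma prim_derive_line q d : rho (prim gamma q) != 0 ->
  state_is_derive (fun h : R => prim gamma (h *: d + q)) 0
    (tangent gamma (prim gamma q) d).
Proof.
move=> r0; have q0 : 0 *: d + q = q by rewrite scale0r add0r.
rewrite -{2}q0; apply: prim_derive; last by rewrite q0.
move=> i; under eq_fun do rewrite !mxE.
derive_with; ring.
Qed.

(** Needed because a second partial derivative differentiates the gradient,
    whose closed form only holds at admissible states. *)
Lemma near_admissible (Y : R -> state R) (t : R) T :
  state_is_derive Y t T -> admissible (Y t) -> \forall x \near t, admissible (Y x).
Proof.
move=> [dr] [_] [_] [_] [dp _] [r0 p0].
have := is_derive_near_gt0 dr r0; have := is_derive_near_gt0 dp p0.
by apply: filterS2.
Qed.

Lemma gradient_entropy q : admissible (prim gamma q) ->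
  gradient (entropy_cons gamma) q = entropy_var_formula gamma (prim gamma q).
Proof.
move=> adm; have r0 : rho (prim gamma q) != 0 by case: adm => /lt0r_neq0.
have q0 d : 0 *: d + q = q by rewrite scale0r add0r.
apply/colP => i; rewrite mxE; apply: derive_along_line.
have := @entropy_derive R gamma gamma_gt1
  (fun h : R => prim gamma (h *: delta_mx i 0 + q)) 0 (delta_mx i 0).
rewrite q0 => /(_ adm (prim_derive_line _ r0)).
rewrite /dot (bigD1 i) //= big1 ?addr0 => [|j ji]; last first.
  by rewrite [delta_mx _ _ _ _]mxE (negPf ji) mulr0.
by rewrite [delta_mx _ _ _ _]mxE !eqxx mulr1.
Qed.

Lemma entropy_varE X : admissible X ->
  entropy_var gamma X = entropy_var_formula gamma X.
Proof.
move=> [r0 p0]; have XE := @consK R gamma X.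
by rewrite /entropy_var gradient_entropy XE ?gt_eqF.
Qed.

Lemma entropy_hessianE X i j : admissible X ->
  entropy_hessian gamma X i j
    = entropy_form gamma X (delta_mx i 0) (delta_mx j 0).
Proof.
move=> adm; have [r0 p0] := adm.
have XE : prim gamma (cons gamma X) = X by rewrite consK ?gt_eqF.
set q := cons gamma X in XE *; set d := delta_mx j 0.
have q0 : 0 *: d + q = q by rewrite scale0r add0r.
have dY : state_is_derive (fun h : R => prim gamma (h *: d + q)) 0 (tangent gamma X d).
  by rewrite -[X in tangent _ X]XE; apply: prim_derive_line; rewrite XE gt_eqF.
rewrite mxE -/q -/d; apply: derive_along_line.
have := @entropy_var_derive R gamma gamma_gt1 _ 0 d i; move=> /(_ _ _).
move=> /(_ (fun h : R => prim gamma (h *: d + q))); rewrite q0 XE => /(_ adm dY).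
apply: near_eq_is_derive.
have := near_admissible dY; rewrite q0 XE => /(_ adm).
by apply: filterS => h hadm; rewrite gradient_entropy.
Qed.

Definition entropy_coord_mx X : 'M[R]_8 :=
  \matrix_(i, j) entropy_coord gamma X (delta_mx j 0) i 0.

Lemma delta_inord j k : (k < 8)%N ->
  (delta_mx j 0 : 'cV[R]_8) (inord k) 0 = (k == j)%:R.
Proof. by move=> k8; rewrite mxE andbT -val_eqE /= inordK. Qed.

Lemma entropy_coordE X d : entropy_coord gamma X d = entropy_coord_mx X *m d.
Proof.
apply/colP; elim/ordinal8_ind.
all: rewrite [RHS]mxE sum_inord8 !mxE !inordK //= !delta_inord // !inordK //= /usq; ring.
Qed.

(** Expressing the Hessian as a congruence of a diagonal matrix reduces the
    inversion of the Hessian to the orthogonality of eigenvectors. *)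
Lemma entropy_hessian_factor X : admissible X ->
  entropy_hessian gamma X
    = (entropy_coord_mx X)^T *m diag_mx (entropy_weight gamma X) *m entropy_coord_mx X.
Proof.
move=> adm; apply/matrixP => i j; rewrite entropy_hessianE // mxE.
apply: eq_bigr => k _; rewrite mul_mx_diag.
rewrite [in RHS]mxE [_^T i k]mxE ![entropy_coord_mx _ _ _]mxE.
by ring.
Qed.

End Hessian.

(** * Fast and slow wave speeds *)

Section WaveSpeeds.
Variables (R : realType) (gamma : R) (X : state R).
Hypotheses (gamma_gt1 : 1 < gamma) (admX : admissible X) (bperp_gt0 : 0 < bperp X).

Let rho_gt0 : 0 < rho X. Proof. by case: admX. Qed.
Let p_gt0 : 0 < p X. Proof. by case: admX. Qed.

Let a2 := sound gamma X ^+ 2.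
Let bp2 := b2 X ^+ 2 + b3 X ^+ 2.

Lemma sound_sqr : sound gamma X ^+ 2 = gamma * p X / rho X.
Proof. by rewrite sqr_sqrtr // divr_ge0 ?mulr_ge0 ?ltW // (lt_trans ltr01). Qed.

Let a2_gt0 : 0 < a2.
Proof. by rewrite /a2 sound_sqr divr_gt0 ?mulr_gt0 // (lt_trans ltr01). Qed.

Lemma bperp_sqr : bperp X ^+ 2 = b2 X ^+ 2 + b3 X ^+ 2.
Proof. by rewrite sqr_sqrtr // addr_ge0 ?sqr_ge0. Qed.

Let bp2_gt0 : 0 < bp2. Proof. by rewrite /bp2 -bperp_sqr exprn_gt0. Qed.

Let bsqE : bsq X = b1 X ^+ 2 + bp2. Proof. by rewrite /bsq -addrA. Qed.

(** A sum of squares, positive exactly because the transverse field does not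
    vanish; this separates the fast and slow speeds and also gives
    |a^2 - b^2| <= sqrt discr, which makes both alphas square roots of
    nonnegative numbers. *)
Lemma discr_sum_sqr :
  discr gamma X = (sound gamma X ^+ 2 - bsq X) ^+ 2
                  + 4 * sound gamma X ^+ 2 * (b2 X ^+ 2 + b3 X ^+ 2).
Proof. by rewrite /discr /bsq; ring. Qed.

Let discr_gt0 : 0 < discr gamma X.
Proof.
by rewrite discr_sum_sqr ltr_wpDl ?sqr_ge0 // mulr_gt0 // mulr_gt0.
Qed.

Let rt := Num.sqrt (discr gamma X).

Let rt_gt0 : 0 < rt. Proof. by rewrite sqrtr_gt0. Qed.

Let abs_le_rt : `|a2 - bsq X| <= rt.
Proof.
rewrite -sqrtr_sqr ler_sqrt ?(ltW discr_gt0) // discr_sum_sqr lerDl.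
by rewrite ltW // mulr_gt0 // mulr_gt0.
Qed.

Let rt_le : rt <= a2 + bsq X.
Proof.
have S0 : 0 <= a2 + bsq X by rewrite addr_ge0 ?(ltW a2_gt0) // bsqE addr_ge0 ?sqr_ge0 // ltW.
rewrite -[leRHS]ger0_norm // -sqrtr_sqr ler_sqrt ?sqr_ge0 // /discr -/a2.
by rewrite lerBlDr lerDl mulr_ge0 ?sqr_ge0 // mulr_ge0 // ltW.
Qed.

Lemma cfast_sqr : cfast gamma X ^+ 2 =
  2^-1 * ((sound gamma X ^+ 2 + bsq X) + Num.sqrt (discr gamma X)).
Proof.
rewrite sqr_sqrtr // -/a2 -/rt mulr_ge0 ?invr_ge0 // addr_ge0 ?(ltW rt_gt0) //.
exact: le_trans (ltW rt_gt0) rt_le.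
Qed.

Lemma cslow_sqr : cslow gamma X ^+ 2 =
  2^-1 * ((sound gamma X ^+ 2 + bsq X) - Num.sqrt (discr gamma X)).
Proof. by rewrite sqr_sqrtr // mulr_ge0 ?invr_ge0 // subr_ge0. Qed.

Let speed_gap : cfast gamma X ^+ 2 - cslow gamma X ^+ 2 = rt.
Proof. by rewrite cfast_sqr cslow_sqr -/rt; field. Qed.

Lemma alphaf_sqr : alphaf gamma X ^+ 2 =
  (sound gamma X ^+ 2 - cslow gamma X ^+ 2)
    / (cfast gamma X ^+ 2 - cslow gamma X ^+ 2).
Proof.
rewrite sqr_sqrtr // speed_gap divr_ge0 ?(ltW rt_gt0) // cslow_sqr -/a2 -/rt.
by move: abs_le_rt; rewrite ler_norml; lra.
Qed.

Lemma alphas_sqr : alphas gamma X ^+ 2 =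
  (cfast gamma X ^+ 2 - sound gamma X ^+ 2)
    / (cfast gamma X ^+ 2 - cslow gamma X ^+ 2).
Proof.
rewrite sqr_sqrtr // speed_gap divr_ge0 ?(ltW rt_gt0) // cfast_sqr -/a2 -/rt.
by move: abs_le_rt; rewrite ler_norml; lra.
Qed.

Lemma alpha_sqr_sum : alphaf gamma X ^+ 2 + alphas gamma X ^+ 2 = 1.
Proof.
rewrite alphaf_sqr alphas_sqr; field.
by rewrite speed_gap gt_eqF.
Qed.

(** The alphas are the weights for which a^2 is the mean of cf^2 and cs^2; this
    normalizes the kinetic part of the fast and slow waves. *)
Lemma alpha_speed_sqr_sum :
  alphaf gamma X ^+ 2 * cfast gamma X ^+ 2
    + alphas gamma X ^+ 2 * cslow gamma X ^+ 2 = sound gamma X ^+ 2.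
Proof.
rewrite alphaf_sqr alphas_sqr; field.
by rewrite speed_gap gt_eqF.
Qed.

Lemma sgn0_sqr (x : R) : sgn0 x ^+ 2 = 1.
Proof. by rewrite /sgn0; case: ifP; rewrite ?sqrrN expr1n. Qed.

Lemma beta_sqr_sum : beta2 X ^+ 2 + beta3 X ^+ 2 = 1.
Proof.
rewrite /beta2 /beta3 !(expr_div_n _ (bperp X)) -mulrDl -bperp_sqr divff //.
by rewrite expf_neq0 // gt_eqF.
Qed.

(** With [B3E], the transverse field is its modulus times the unit vector
    (beta2, beta3). *)
Lemma B2E : B2 X = Num.sqrt (rho X) * bperp X * beta2 X.
Proof. by rewrite /beta2 /b2; field; rewrite !gt_eqF // sqrtr_gt0. Qed.

Lemma B3E : B3 X = Num.sqrt (rho X) * bperp X * beta3 X.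
Proof. by rewrite /beta3 /b3; field; rewrite !gt_eqF // sqrtr_gt0. Qed.

Lemma powR_three_halves : rho X `^ (3 / 2) = rho X * Num.sqrt (rho X).
Proof.
rewrite -powR12_sqrt ?ltW // -{2}[rho X]powRr1 ?ltW // -powRD.
  by congr (_ `^ _); field.
by rewrite (gt_eqF rho_gt0) implybT.
Qed.

End WaveSpeeds.

(** * Orthogonality of the eigenvectors for the entropy Hessian *)

Section Eigenvectors.
Variables (R : realType) (gamma : R) (X : state R).
Hypotheses (gamma_gt1 : 1 < gamma) (admX : admissible X) (bperp_gt0 : 0 < bperp X).
Implicit Types (e : R) (d : 'cV[R]_8).

Let rho_gt0 : 0 < rho X. Proof. by case: admX. Qed.
Let rho_neq0 : rho X != 0. Proof. by rewrite gt_eqF. Qed.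
Let p_gt0 : 0 < p X. Proof. by case: admX. Qed.
Let p_neq0 : p X != 0. Proof. by rewrite gt_eqF. Qed.
Let gamma1_neq0 : gamma - 1 != 0. Proof. by rewrite subr_eq0 gt_eqF. Qed.

Notation s := (Num.sqrt (rho X)).
Notation a := (sound gamma X).
Notation af := (alphaf gamma X).
Notation als := (alphas gamma X).
Notation cf := (cfast gamma X).
Notation cs := (cslow gamma X).
Notation sg := (sgn0 (b1 X)).
Notation be2 := (beta2 X).
Notation be3 := (beta3 X).

Let sqrt_rho_sqr : s ^+ 2 = rho X. Proof. by rewrite sqr_sqrtr // ltW. Qed.
Let be_sum : be2 ^+ 2 + be3 ^+ 2 = 1. Proof. exact: beta_sqr_sum. Qed.
Let B2_be : B2 X = s * bperp X * be2. Proof. exact: B2E. Qed.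
Let B3_be : B3 X = s * bperp X * be3. Proof. exact: B3E. Qed.
Let al_sum : af ^+ 2 + als ^+ 2 = 1. Proof. exact: alpha_sqr_sum. Qed.
Let al_speed : af ^+ 2 * cf ^+ 2 + als ^+ 2 * cs ^+ 2 = a ^+ 2.
Proof. exact: alpha_speed_sqr_sum. Qed.
Let sg2 : sg ^+ 2 = 1. Proof. exact: sgn0_sqr. Qed.

(** Magnetic work along the fast and slow waves: it cancels the bperp term of
    [Psi_f] and [Psi_s] in the pressure component. *)
Lemma transverse_field_dot c :
  B2 X * (c * be2 * s) + B3 X * (c * be3 * s) = c * rho X * bperp X.
Proof.
transitivity (c * s ^+ 2 * bperp X * (be2 ^+ 2 + be3 ^+ 2)).
  by rewrite B2_be B3_be; ring.
by rewrite be_sum sqrt_rho_sqr mulr1.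
Qed.

Let sound_p : rho X * a ^+ 2 = gamma * p X.
Proof. by rewrite sound_sqr //; field; rewrite ?(rho_neq0, p_neq0, gamma1_neq0). Qed.

(** In the coordinates [entropy_coord] the eigenvectors lose their dependence on
    the velocity.  The fifth entry of the fast and slow waves is
    alpha * (1 - gamma) because such a wave has dp = a^2 drho. *)
Lemma entropy_coord_f e : entropy_coord gamma X (rhat_f gamma e X) =
  vec8 [:: af * rho X; e * (af * cf); - (e * (als * cs * be2 * sg));
           - (e * (als * cs * be3 * sg)); af * (1 - gamma); 0;
           als * a * be2 * s; als * a * be3 * s].
Proof.
rewrite /entropy_coord /tangent /= !mxE !inordK //=.
congr (vec8 [:: _; _; _; _; _; _; _; _]); try by field.
rewrite mulr0 add0r transverse_field_dot /Psi_f /usq.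
transitivity (af - af * (rho X * a ^+ 2) / p X).
  by field; rewrite ?(rho_neq0, p_neq0, gamma1_neq0).
by rewrite sound_p; field.
Qed.

Lemma entropy_coord_s e : entropy_coord gamma X (rhat_s gamma e X) =
  vec8 [:: als * rho X; e * (als * cs); e * (af * cf * be2 * sg);
           e * (af * cf * be3 * sg); als * (1 - gamma); 0;
           - (af * a * be2 * s); - (af * a * be3 * s)].
Proof.
rewrite /entropy_coord /tangent /= !mxE !inordK //=.
congr (vec8 [:: _; _; _; _; _; _; _; _]); try by field.
rewrite mulr0 add0r !mulrN -opprD transverse_field_dot /Psi_s /usq.
transitivity (als - als * (rho X * a ^+ 2) / p X).
  by field; rewrite ?(rho_neq0, p_neq0, gamma1_neq0).
by rewrite sound_p; field.
Qed.

Lemma entropy_coord_a e : entropy_coord gamma X (rhat_a e X) =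
  vec8 [:: 0; 0; e * (s * be3); - (e * (s * be2)); 0; 0;
           - (rho X * be3); rho X * be2].
Proof.
rewrite /entropy_coord /tangent /= !mxE !inordK //= powR_three_halves //.
congr (vec8 [:: _; _; _; _; _; _; _; _]); try by field.
by rewrite B2_be B3_be; field; rewrite ?(rho_neq0, p_neq0, gamma1_neq0).
Qed.

Lemma entropy_coord_E : entropy_coord gamma X (rhat_E X) =
  vec8 [:: 1; 0; 0; 0; (rho X)^-1; 0; 0; 0].
Proof.
rewrite /entropy_coord /tangent /= !mxE !inordK //=.
congr (vec8 [:: _; _; _; _; _; _; _; _]); rewrite /usq; field.
all: by rewrite ?(rho_neq0, p_neq0, gamma1_neq0).
Qed.

Lemma entropy_coord_D : entropy_coord gamma X (rhat_D X) =
  vec8 [:: 0; 0; 0; 0; 0; 1; 0; 0].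
Proof.
rewrite /entropy_coord /tangent /= !mxE !inordK //=.
congr (vec8 [:: _; _; _; _; _; _; _; _]); field; by rewrite ?(rho_neq0, p_neq0, gamma1_neq0).
Qed.

Lemma entropy_formC d d' :
  entropy_form gamma X d d' = entropy_form gamma X d' d.
Proof. by apply: eq_bigr => i _; rewrite mulrAC. Qed.

(** Makes the kinetic, magnetic and thermodynamic terms of a magnetoacoustic
    wave comparable. *)
Lemma beta_sound : 2 * beta X * a ^+ 2 = gamma.
Proof. by rewrite /beta sound_sqr //; field; rewrite ?(rho_neq0, p_neq0, gamma1_neq0). Qed.

Ltac expand_form :=
  rewrite /entropy_form sum_inord8 ?(entropy_coord_f, entropy_coord_s,
    entropy_coord_a, entropy_coord_E, entropy_coord_D) !mxE !inordK //=.

(** The kinetic contribution, odd in each sign, is of the same size as the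
    thermodynamic and magnetic ones together; hence opposite waves are orthogonal, and
    waves of the same sign have squared length 2 rho gamma. *)
Lemma entropy_form_ff e e' :
  entropy_form gamma X (rhat_f gamma e X) (rhat_f gamma e' X)
    = rho X * gamma * (1 + e * e').
Proof.
expand_form.
transitivity (rho X * (af ^+ 2 * gamma
   + (2 * beta X) * (e * e') * (af ^+ 2 * cf ^+ 2
       + als ^+ 2 * cs ^+ 2 * (sg ^+ 2 * (be2 ^+ 2 + be3 ^+ 2)))
   + (2 * beta X * a ^+ 2) * als ^+ 2 * (be2 ^+ 2 + be3 ^+ 2) * (s ^+ 2 / rho X))).
  by field; rewrite ?(rho_neq0, p_neq0, gamma1_neq0).
rewrite be_sum sg2 sqrt_rho_sqr divff // !mulr1 al_speed beta_sound.
transitivity (rho X * (gamma * (af ^+ 2 + als ^+ 2) + 2 * beta X * a ^+ 2 * (e * e'))).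
  by ring.
by rewrite al_sum beta_sound; ring.
Qed.

Lemma entropy_form_ss e e' :
  entropy_form gamma X (rhat_s gamma e X) (rhat_s gamma e' X)
    = rho X * gamma * (1 + e * e').
Proof.
expand_form.
transitivity (rho X * (als ^+ 2 * gamma
   + (2 * beta X) * (e * e') * (af ^+ 2 * cf ^+ 2 * (sg ^+ 2 * (be2 ^+ 2 + be3 ^+ 2))
       + als ^+ 2 * cs ^+ 2)
   + (2 * beta X * a ^+ 2) * af ^+ 2 * (be2 ^+ 2 + be3 ^+ 2) * (s ^+ 2 / rho X))).
  by field; rewrite ?(rho_neq0, p_neq0, gamma1_neq0).
rewrite be_sum sg2 sqrt_rho_sqr divff // !mulr1 al_speed beta_sound.
transitivity (rho X * (gamma * (af ^+ 2 + als ^+ 2) + 2 * beta X * a ^+ 2 * (e * e'))).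
  by ring.
by rewrite al_sum beta_sound; ring.
Qed.

(** The kinetic terms cancel among themselves because (beta2, beta3) is a unit
    vector; the thermodynamic and magnetic terms cancel by [beta_sound]. *)
Lemma entropy_form_fs e e' :
  entropy_form gamma X (rhat_f gamma e X) (rhat_s gamma e' X) = 0.
Proof.
expand_form.
transitivity (rho X * af * als * (gamma
   + (2 * beta X) * (e * e') * cf * cs * (1 - sg ^+ 2 * (be2 ^+ 2 + be3 ^+ 2))
   - (2 * beta X * a ^+ 2) * (be2 ^+ 2 + be3 ^+ 2) * (s ^+ 2 / rho X))).
  by field; rewrite ?(rho_neq0, p_neq0, gamma1_neq0).
by rewrite be_sum sg2 sqrt_rho_sqr divff // beta_sound; ring.
Qed.

Lemma entropy_form_aa e e' :
  entropy_form gamma X (rhat_a e X) (rhat_a e' X)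
    = rho X ^+ 3 / p X * (1 + e * e').
Proof.
expand_form.
transitivity (2 * beta X * rho X * (be2 ^+ 2 + be3 ^+ 2) * (rho X + e * e' * s ^+ 2)).
  by ring.
by rewrite be_sum sqrt_rho_sqr /beta; field.
Qed.

Lemma entropy_form_EE :
  entropy_form gamma X (rhat_E X) (rhat_E X) = gamma / (rho X * (gamma - 1)).
Proof. by expand_form; field; rewrite ?(rho_neq0, p_neq0, gamma1_neq0). Qed.

Lemma entropy_form_DD :
  entropy_form gamma X (rhat_D X) (rhat_D X) = rho X / p X.
Proof.
by expand_form; rewrite /beta; field; rewrite ?(rho_neq0, p_neq0, gamma1_neq0).
Qed.

Lemma entropy_form_fa e e' :
  entropy_form gamma X (rhat_f gamma e X) (rhat_a e' X) = 0.
Proof. by expand_form; ring. Qed.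

Lemma entropy_form_sa e e' :
  entropy_form gamma X (rhat_s gamma e X) (rhat_a e' X) = 0.
Proof. by expand_form; ring. Qed.

Lemma entropy_form_fE e :
  entropy_form gamma X (rhat_f gamma e X) (rhat_E X) = 0.
Proof. by expand_form; field; rewrite ?(rho_neq0, p_neq0, gamma1_neq0). Qed.

Lemma entropy_form_sE e :
  entropy_form gamma X (rhat_s gamma e X) (rhat_E X) = 0.
Proof. by expand_form; field; rewrite ?(rho_neq0, p_neq0, gamma1_neq0). Qed.

Lemma entropy_form_aE e : entropy_form gamma X (rhat_a e X) (rhat_E X) = 0.
Proof. by expand_form; ring. Qed.

Lemma entropy_form_fD e :
  entropy_form gamma X (rhat_f gamma e X) (rhat_D X) = 0.
Proof. by expand_form; ring. Qed.

Lemma entropy_form_sD e :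
  entropy_form gamma X (rhat_s gamma e X) (rhat_D X) = 0.
Proof. by expand_form; ring. Qed.

Lemma entropy_form_aD e : entropy_form gamma X (rhat_a e X) (rhat_D X) = 0.
Proof. by expand_form; ring. Qed.

Lemma entropy_form_ED : entropy_form gamma X (rhat_E X) (rhat_D X) = 0.
Proof. by expand_form; ring. Qed.

End Eigenvectors.

(** * Factorization of the entropy Jacobian *)

Section Scaling.
Variables (R : realType) (gamma : R) (X : state R).
Hypotheses (gamma_gt1 : 1 < gamma) (admX : admissible X) (bperp_gt0 : 0 < bperp X).

Let rho_gt0 : 0 < rho X. Proof. by case: admX. Qed.
Let p_gt0 : 0 < p X. Proof. by case: admX. Qed.
Let gamma1_gt0 : 0 < gamma - 1. Proof. by rewrite subr_gt0. Qed.
Let gamma_gt0 : 0 < gamma. Proof. exact: lt_trans ltr01 gamma_gt1. Qed.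

(** The diagonal entries of T are the inverse lengths of the eigenvectors for
    the second derivative of the entropy. *)
Lemma Tscal_normalizes i j :
  Tscal gamma X i i * Tscal gamma X j j
    * entropy_form gamma X (col i (Rhat gamma X)) (col j (Rhat gamma X))
  = (i == j)%:R.
Proof.
have tE : 1 / Num.sqrt (2 * rho X * gamma) * (1 / Num.sqrt (2 * rho X * gamma))
            = (2 * rho X * gamma)^-1.
  by rewrite !mul1r -expr2 exprVn sqr_sqrtr // ltW // !mulr_gt0.
have taE : Num.sqrt (p X / (2 * rho X ^+ 3)) * Num.sqrt (p X / (2 * rho X ^+ 3))
            = p X / (2 * rho X ^+ 3).
  by rewrite -expr2 sqr_sqrtr // ltW // divr_gt0 // mulr_gt0 // exprn_gt0.
have tEE : Num.sqrt (rho X * (gamma - 1) / gamma) * Num.sqrt (rho X * (gamma - 1) / gamma)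
            = rho X * (gamma - 1) / gamma.
  by rewrite -expr2 sqr_sqrtr // ltW // divr_gt0 // mulr_gt0.
have tDE : Num.sqrt (p X / rho X) * Num.sqrt (p X / rho X) = p X / rho X.
  by rewrite -expr2 sqr_sqrtr // ltW // divr_gt0.
have colE k : (k < 8)%N -> col (inord k) (Rhat gamma X) =
  [:: rhat_f gamma 1 X; rhat_a 1 X; rhat_s gamma 1 X; rhat_E X; rhat_D X;
      rhat_s gamma (-1) X; rhat_a (-1) X; rhat_f gamma (-1) X]`_k.
  by move=> k8; apply/colP => l; rewrite !mxE inordK.
have [r0 p0 g0 g10] : [/\ rho X != 0, p X != 0, gamma != 0 & gamma - 1 != 0].
  by rewrite !gt_eqF.
elim/ordinal8_ind: i; elim/ordinal8_ind: j.
all: rewrite !colE // /Tscal !mxE !eqxx /= !mulr1n !inordK //= -?val_eqE /= ?inordK //=.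
all: rewrite ?(entropy_form_ff, entropy_form_ss, entropy_form_fs, entropy_form_aa,
  entropy_form_EE, entropy_form_DD, entropy_form_fa, entropy_form_sa,
  entropy_form_fE, entropy_form_sE, entropy_form_aE, entropy_form_fD,
  entropy_form_sD, entropy_form_aD, entropy_form_ED) //.
(* The forms still present pair the eigenvectors in the order opposite to that
   of the lemmas. *)
all: rewrite 1?[entropy_form _ _ _ _]entropy_formC ?(entropy_form_fs,
  entropy_form_fa, entropy_form_sa,
  entropy_form_fE, entropy_form_sE, entropy_form_aE, entropy_form_fD,
  entropy_form_sD, entropy_form_aD, entropy_form_ED) //.
all: rewrite ?(tE, taE, tEE, tDE) ?mulr1 ?mul1r ?mulrN1 ?mulNr1 ?opprK ?subrr ?mulr0 //.
all: by field; rewrite ?(r0, p0, g0, g10).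
Qed.

(** For H' the Hessian and Y = R T, the identity Y^T H' Y = 1 means that Y
    is invertible and that Y Y^T is the inverse of H'. *)
Lemma Rhat_Tscal_orthonormal :
  (Rhat gamma X *m Tscal gamma X)^T *m entropy_hessian gamma X
    *m (Rhat gamma X *m Tscal gamma X) = 1%:M.
Proof.
rewrite entropy_hessian_factor // !mulmxA -trmx_mul -mulmxA.
rewrite -[_ *m entropy_coord_mx _ _ *m _]mulmxA.
set Y := Rhat gamma X *m Tscal gamma X.
have NY k j : (entropy_coord_mx gamma X *m Y) k j
    = Tscal gamma X j j * entropy_coord gamma X (col j (Rhat gamma X)) k 0.
  rewrite entropy_coordE colE [in RHS]mulmxA -colE [col _ _ _ _]mxE /Y mulmxA.
  by rewrite /Tscal /diag8 mul_mx_diag mxE [diag_mx _ _ _]mxE eqxx mulr1n mulrC.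
apply/matrixP => i j; rewrite [RHS]mxE -(Tscal_normalizes i j).
rewrite mxE mulr_sumr; apply: eq_bigr => k _.
by rewrite mul_mx_diag [in LHS]mxE [_^T i k]mxE !NY; ring.
Qed.

Lemma entropy_hessian_inverse :
  entropy_hessian gamma X *m
    ((Rhat gamma X *m Tscal gamma X) *m (Rhat gamma X *m Tscal gamma X)^T) = 1%:M.
Proof.
have := Rhat_Tscal_orthonormal; set Y := _ *m Tscal _ _.
by rewrite -mulmxA => /mulmx1C; rewrite -mulmxA.
Qed.

Lemma entropy_jacobian_factor :
  [/\ entropy_hessian gamma X \in unitmx,
      entropy_jacobian gamma X
        = (Rhat gamma X *m Tscal gamma X) *m (Rhat gamma X *m Tscal gamma X)^T
    & entropy_jacobian gamma X
        = Rhat gamma X *m Zscal gamma X *m (Rhat gamma X)^T].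
Proof.
have HP := entropy_hessian_inverse.
have [Hu _] := mulmx1_unit HP.
have JE : entropy_jacobian gamma X
    = (Rhat gamma X *m Tscal gamma X) *m (Rhat gamma X *m Tscal gamma X)^T.
  by rewrite -[RHS](mulKmx Hu) HP mulmx1.
split=> //; rewrite JE trmx_mul tr_diag_mx /Zscal expr2.
by rewrite !mulmxA.
Qed.

End Scaling.

(** * Entropy conservation of the baseline flux *)

Section Conservation.
Variables (R : realType) (gamma : R).
Hypothesis gamma_gt1 : 1 < gamma.
Implicit Types (X XL XR : state R) (a b : R).

Lemma lnmean_gt0 a b : 0 < a -> 0 < b -> 0 < lnmean a b.
Proof.
move=> a0 b0; rewrite /lnmean; case: (ltgtP a b) => // ab.
  by rewrite -mulrNN -invrN !opprB divr_gt0 // subr_gt0 // ltr_ln.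
by rewrite divr_gt0 // subr_gt0 // ltr_ln.
Qed.

(** The logarithmic mean turns jumps of logarithms into rational expressions,
    so that entropy conservation becomes an identity between rational
    functions. *)
Lemma ln_jump a b : 0 < a -> 0 < b -> ln b = ln a + (b - a) / lnmean a b.
Proof.
move=> a0 b0; rewrite /lnmean; case: (eqVneq a b) => [->|ab].
  by rewrite subrr mul0r addr0.
have lab : ln a - ln b != 0.
  by rewrite subr_eq0; apply: contraNneq ab => /ln_inj ->.
have abn : a - b != 0 by rewrite subr_eq0.
by field; rewrite lab abn.
Qed.

(** Written in rho and beta, the logarithms occur exactly in the combination
    that the two logarithmic means of the flux resolve. *)
Lemma phys_entropyE X : admissible X ->
  phys_entropy gamma X = - (ln (beta X) + ln 2 + (gamma - 1) * ln (rho X)).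
Proof.
move=> [r0 p0]; rewrite /phys_entropy /beta lnM ?posrE ?invr_gt0 ?mulr_gt0 //.
by rewrite lnV ?posrE ?mulr_gt0 // lnM ?posrE //; ring.
Qed.

(** The entropy flux potential v . f - F; see [flux_potentialE]. *)
Definition flux_potential X : R :=
  rho X * u X + beta X * u X * Bsq X - 2 * beta X * B1 X * udotB X.

Lemma flux_potentialE X : admissible X ->
  dot (entropy_var_formula gamma X) (flux gamma X) - entropy_flux gamma X
    = flux_potential X.
Proof.
move=> [r0 p0]; rewrite /dot sum_inord8 !mxE !inordK //=.
rewrite /entropy_flux /entropy /flux_potential /udotB /beta /Bsq /usq.
field; by rewrite ?(gt_eqF r0) ?(gt_eqF p0) ?subr_eq0 ?(gt_eqF gamma_gt1).
Qed.

(** Tadmor's condition for entropy conservation, up to a defect proportional to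
    the jump of B1, which is the discrete divergence of the magnetic field.  The
    source term compensates the defect, see [source_work]. *)
Lemma KEPEC_jump XL XR : admissible XL -> admissible XR ->
  dot (entropy_var_formula gamma XR - entropy_var_formula gamma XL)
      (flux_KEPEC gamma XL XR)
  = flux_potential XR - flux_potential XL
    + 2 * (B1 XR - B1 XL) * avg (beta XL) (beta XR)
      * (avg (u XL) (u XR) * avg (B1 XL) (B1 XR)
         + avg (v XL) (v XR) * avg (B2 XL) (B2 XR)
         + avg (w XL) (w XR) * avg (B3 XL) (B3 XR)).
Proof.
move=> admL admR; have [rL pL] := admL; have [rR pR] := admR.
have bL : 0 < beta XL by rewrite divr_gt0 // mulr_gt0.
have bR : 0 < beta XR by rewrite divr_gt0 // mulr_gt0.
rewrite /dot sum_inord8 !mxE !inordK //= !phys_entropyE //.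
rewrite (ln_jump rL rR) (ln_jump bL bR).
have := lnmean_gt0 rL rR; have := lnmean_gt0 bL bR.
rewrite /flux_potential /udotB /Bsq /usq /avg.
move: (lnmean (rho XL) _) (lnmean (beta XL) _) => rln bln.
move: (beta XL) (beta XR) bL bR => betaL betaR bL bR bln0 rln0.
field.
rewrite ?(gt_eqF bln0) ?(gt_eqF rln0) ?subr_eq0 ?(gt_eqF gamma_gt1) /=.
by rewrite gt_eqF // addr_gt0.
Qed.

End Conservation.

(** * Entropy stability *)

Section Stability.
Variables (R : realType) (gamma : R).
Hypothesis gamma_gt1 : 1 < gamma.
Implicit Types X : state R.

(** With y = R^T d, the product is the sum of the |lambda_i| (t_i y_i)^2. *)
Lemma dissipation_ge0 X (d : 'cV[R]_8) :
  0 <= dot d (Rhat gamma X *m absLambda gamma X *m Zscal gamma X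
              *m (Rhat gamma X)^T *m d).
Proof.
set y := (Rhat gamma X)^T *m d.
have -> : Rhat gamma X *m absLambda gamma X *m Zscal gamma X *m (Rhat gamma X)^T *m d
   = Rhat gamma X *m (absLambda gamma X *m (Tscal gamma X *m (Tscal gamma X *m y))).
  by rewrite /y !mulmxA.
have dotE (z : 'cV[R]_8) : dot d (Rhat gamma X *m z) = dot y z.
  have dotmx (a b : 'cV[R]_8) : dot a b = (a^T *m b) 0 0.
    by rewrite mxE; apply: eq_bigr => i _; rewrite mxE.
  by rewrite !dotmx /y trmx_mul trmxK mulmxA.
rewrite dotE; apply: sumr_ge0 => i _.
have -> : absLambda gamma X = diag_mx (\row_i absLambda gamma X i i).
  apply/matrixP => k l; rewrite [RHS]mxE; case: (eqVneq k l) => [<-|kl].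
    by rewrite [in RHS]mxE mulr1n.
  by rewrite !mxE (negPf kl) !mulr0n normr0.
have diagE (l r : 'rV[R]_8) (z : 'cV[R]_8) k :
    z k 0 * (diag_mx l *m (diag_mx r *m (diag_mx r *m z))) k 0
      = l 0 k * (r 0 k * z k 0) ^+ 2.
  by rewrite !mul_diag_mx !mxE; ring.
by rewrite /Tscal /diag8 diagE mulr_ge0 ?sqr_ge0 // !mxE.
Qed.

(** The magnetic entropy variables are 2 beta B_k, so their sum weighted by
    the cell widths reproduces the denominators of the source term: the result
    does not depend on the cell widths. *)
Lemma source_work dxL dxR XL XR : source_defined dxL dxR XL XR ->
  2^-1 * (dxL * dot (entropy_var_formula gamma XL) (s_interface dxL dxR XL XR)
          + dxR * dot (entropy_var_formula gamma XR) (s_interface dxL dxR XL XR))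
  = - (2 * (B1 XR - B1 XL) * avg (beta XL) (beta XR)
       * (avg (u XL) (u XR) * avg (B1 XL) (B1 XR)
          + avg (v XL) (v XR) * avg (B2 XL) (B2 XR)
          + avg (w XL) (w XR) * avg (B3 XL) (B3 XR))).
Proof.
case=> d1 d2 d3.
rewrite /dot !sum_inord8 !mxE !inordK //=.
have dE g : dxL * beta XL * g XL + dxR * beta XR * g XR
    = 2 * avg_dxbeta dxL dxR XL XR g.
  by rewrite /avg_dxbeta /avg; field.
transitivity (- (B1 XR - B1 XL) * avg (beta XL) (beta XR) *
  ((dxL * beta XL * B1 XL + dxR * beta XR * B1 XR) / avg_dxbeta dxL dxR XL XR B1
     * (avg (u XL) (u XR) * avg (B1 XL) (B1 XR))
   + (dxL * beta XL * B2 XL + dxR * beta XR * B2 XR) / avg_dxbeta dxL dxR XL XR B2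
     * (avg (v XL) (v XR) * avg (B2 XL) (B2 XR))
   + (dxL * beta XL * B3 XL + dxR * beta XR * B3 XR) / avg_dxbeta dxL dxR XL XR B3
     * (avg (w XL) (w XR) * avg (B3 XL) (B3 XR)))).
  by field; rewrite d1 d2 d3 subr_eq0 gt_eqF.
by rewrite !dE; field; rewrite ?d1 ?d2 ?d3.
Qed.

(** Chain rule for the entropy along a curve of states.  The curve is only known
    to be differentiable in the conserved variables; near [t] the density is
    positive, so the states are recovered from them by [prim]. *)
Lemma entropy_rate (Y : R -> state R) (t : R) : admissible (Y t) ->
    derivable (fun x => cons gamma (Y x)) t 1 ->
  is_derive t 1 (fun x => entropy gamma (Y x))
    (dot (entropy_var gamma (Y t)) (derive1 (fun x => cons gamma (Y x)) t)).
Proof.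
move=> adm dq; have [r0 _] := adm.
have dqi i : is_derive t 1 (fun x => cons gamma (Y x) i 0)
    (derive1 (fun x => cons gamma (Y x)) t i 0).
  rewrite derive1E derive_mx // mxE; apply: derivableP.
  by move/derivable_mxP : dq; apply.
have YE : \forall x \near t, prim gamma (cons gamma (Y x)) = Y x.
  have q0 x : cons gamma (Y x) (inord 0) 0 = rho (Y x) by rewrite mxE inordK.
  have := is_derive_near_gt0 (dqi (inord 0)); rewrite q0 => /(_ r0).
  by apply: filterS => x; rewrite q0 => rx; rewrite consK ?gt_eqF.
have Yt := nbhs_singleton YE.
have rn0 : rho (prim gamma (cons gamma (Y t))) != 0 by rewrite Yt gt_eqF.
have := @prim_derive R gamma (fun x => cons gamma (Y x)) t _ dqi rn0.
rewrite /= Yt => dY.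
have := @entropy_derive R gamma gamma_gt1
  (fun x => prim gamma (cons gamma (Y x))) t _.
rewrite Yt => /(_ _ adm dY) dS.
rewrite entropy_varE //; apply: near_eq_is_derive dS.
by apply: filterS YE => x ->.
Qed.

(** Entropy production of an arbitrary interface flux is the work of its
    deviation from the entropy conservative one. *)
Lemma scheme_entropy_rate fhat dxL dxR (XL XR : R -> state R) (t : R) :
    admissible (XL t) -> admissible (XR t) ->
    source_defined dxL dxR (XL t) (XR t) ->
    scheme gamma fhat dxL dxR XL XR t ->
  derive1 (fun tau : R => dxL * entropy gamma (XL tau)
                             + dxR * entropy gamma (XR tau)) t
  + (entropy_flux gamma (XR t) - entropy_flux gamma (XL t))
  = dot (entropy_var gamma (XR t) - entropy_var gamma (XL t))
      (fhat (XL t) (XR t) - flux_KEPEC gamma (XL t) (XR t)).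
Proof.
move=> admL admR src [dL dR eL eR].
rewrite derive1E.
have := is_derive_lamD
  (is_derive_lamM (is_derive_lamC t dxL) (entropy_rate admL dL))
  (is_derive_lamM (is_derive_lamC t dxR) (entropy_rate admR dR)).
move=> [_ ->]; rewrite !mulr0 !addr0 -!dotZr eL eR !entropy_varE //.
have := source_work src.
have := flux_potentialE gamma_gt1 admL; have := flux_potentialE gamma_gt1 admR.
have := KEPEC_jump gamma_gt1 admL admR.
rewrite !(dotDr, dotNr, dotZr, dotDl, dotNl).
(* The defect of the flux and the work of the source are the same atom [k], so
   what remains is linear in the inner products. *)
set k := 2 * (_ - _) * _ * _.
lra.
Qed.

End Stability.

Theorem theorem2 (R : realType) (gamma : R) (hgamma : 1 < gamma) :
  (forall X : state R, admissible X -> 0 < bperp X ->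
     [/\ entropy_hessian gamma X \in unitmx,
         entropy_jacobian gamma X
           = (Rhat gamma X *m Tscal gamma X) *m (Rhat gamma X *m Tscal gamma X)^T
       & entropy_jacobian gamma X
           = Rhat gamma X *m Zscal gamma X *m (Rhat gamma X)^T])
  /\
  (forall XM : state R, admissible XM -> 0 < bperp XM ->
   forall (dxL dxR : R) (XL XR : R -> state R) (t : R),
     0 < dxL -> 0 < dxR ->
     admissible (XL t) -> admissible (XR t) ->
     source_defined dxL dxR (XL t) (XR t) ->
     scheme gamma (flux_KEPES gamma XM) dxL dxR XL XR t ->
     derive1 (fun tau : R => dxL * entropy gamma (XL tau)
                             + dxR * entropy gamma (XR tau)) t
     + (entropy_flux gamma (XR t) - entropy_flux gamma (XL t)) <= 0).
Proof.
split=> [X adm bp | XM _ _ dxL dxR XL XR t _ _ admL admR src sch].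
  exact: entropy_jacobian_factor.
rewrite (scheme_entropy_rate hgamma admL admR src sch).
rewrite /flux_KEPES [_ - _ - _]addrAC subrr add0r dotNr dotZr oppr_le0.
by rewrite mulr_ge0 ?invr_ge0 // dissipation_ge0.
Qed.
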